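(* Let $n$ be a non-negative integer. If $\{(\bar s_k),(\bar\sigma_k)\}$ and $\{(\bar t_k),(\bar\tau_k)\}$, $k=0,1,2,\ldots$, are binomial-transform pairs of the second kind, then \[ \sum_{k=0}^n (-1)^k\binom{n}{k}\bar s_k\,\bar t_{n-k} = \sum_{k=0}^n (-1)^k\binom{n}{k}\bar\sigma_k\,\bar\tau_{n-k}. \]
   Context: Two sequences $(\bar s_k)_{k\ge0}$ and $(\bar\sigma_k)_{k\ge0}$ of complex numbers form a binomial-transform pair of the second kind if $\bar\sigma_n=\sum_{k=0}^n\binom nk \bar s_k$ for every non-negative integer $n$ (equivalently, $\bar s_n=\sum_{k=0}^n(-1)^{n-k}\binom nk\bar\sigma_k$ for every $n\ge0$). *)

(* Defs.v *)
(* The complex numbers are R[i] over an arbitrary model R of the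
   real numbers (R : realType). *)
From mathcomp Require Import all_boot all_order all_algebra.
From mathcomp Require Import reals complex.

Set Implicit Arguments.
Unset Strict Implicit.
Unset Printing Implicit Defensive.

Import GRing.Theory.
Local Open Scope ring_scope.

Definition binomial_pair2 (R : realType) (s sigma : nat -> R[i]) : Prop :=
  forall n : nat, sigma n = \sum_(0 <= k < n.+1) 'C(n, k)%:R * s k.

(* Main.v *)
Require Import Defs.
From mathcomp Require Import all_boot all_order all_algebra.
From mathcomp Require Import reals complex.
From mathcomp Require Import ring.

Import GRing.Theory.
Local Open Scope ring_scope.

(** Write [W n s t] for the alternating convolution and [S] for the shift of
    sequences.  Pascal's rule gives [W (n+1) s t = W n s (S t) - W n (S s) t],
    and also shows that if [(s, sigma)] is a pair then so is
    [(s + S s, S sigma)].  By induction on [n],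
    [W (n+1) sigma tau = W n s (t + S t) - W n (s + S s) t], where the two
    terms [W n s t] cancel. *)

(** Pascal's rule in summed form; it yields both the shifted pair and the recursion for
    [alt_conv]. *)
Lemma sum_binS (A : pzRingType) (n : nat) (f : nat -> A) :
  \sum_(0 <= k < n.+2) 'C(n.+1, k)%:R * f k =
  \sum_(0 <= k < n.+1) 'C(n, k)%:R * (f k + f k.+1).
Proof.
rewrite big_nat_recl // bin0.
under eq_bigr do rewrite binS natrD mulrDl.
under [RHS]eq_bigr do rewrite mulrDr.
rewrite !big_split /= addrA; congr (_ + _).
(* The top term drops out since ['C(n, n.+1)] is 0; the rest, with the term split off at 0, is the
   unshifted sum. *)
by rewrite big_nat_recr //= bin_small // mul0r addr0 [RHS]big_nat_recl // bin0.
Qed.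

Lemma binomial_pair2_shift (R : realType) (s sigma : nat -> R[i]) :
  binomial_pair2 s sigma ->
  binomial_pair2 (fun k => s k + s k.+1) (fun k => sigma k.+1).
Proof. by move=> hs n; rewrite hs sum_binS. Qed.

Definition alt_conv (A : pzRingType) (n : nat) (s t : nat -> A) : A :=
  \sum_(0 <= k < n.+1) (-1) ^+ k * 'C(n, k)%:R * s k * t (n - k)%N.

Lemma alt_convDl (A : pzRingType) (n : nat) (s s' t : nat -> A) :
  alt_conv A n (fun k => s k + s' k) t = alt_conv A n s t + alt_conv A n s' t.
Proof.
by rewrite -big_split; apply: eq_bigr => k _; rewrite mulrDr mulrDl.
Qed.

Lemma alt_convDr (A : pzRingType) (n : nat) (s t t' : nat -> A) :
  alt_conv A n s (fun k => t k + t' k) = alt_conv A n s t + alt_conv A n s t'.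
Proof. by rewrite -big_split; apply: eq_bigr => k _; rewrite mulrDr. Qed.

Lemma alt_convS (A : comNzRingType) (n : nat) (s t : nat -> A) :
  alt_conv A n.+1 s t =
  alt_conv A n s (fun k => t k.+1) - alt_conv A n (fun k => s k.+1) t.
Proof.
(* The sign is absorbed into the summand, so that its change from [k] to [k.+1] produces the
   minus. *)
have -> : alt_conv A n.+1 s t =
    \sum_(0 <= k < n.+2) 'C(n.+1, k)%:R * ((-1) ^+ k * s k * t (n.+1 - k)%N).
  by apply: eq_bigr => k _; ring.
rewrite sum_binS -sumrB; apply: eq_big_nat => k /andP[_ le_kn].
(* [k <= n] turns the truncated [n.+1 - k] into [(n - k).+1], an argument of the shifted [t]. *)
by rewrite subSS subSn // exprS; ring.
Qed.

Theorem theorem5 (R : realType) (n : nat) (s sigma t tau : nat -> R[i])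
    (hs : binomial_pair2 s sigma) (ht : binomial_pair2 t tau) :
  \sum_(0 <= k < n.+1) (-1) ^+ k * 'C(n, k)%:R * s k * t (n - k)%N =
  \sum_(0 <= k < n.+1) (-1) ^+ k * 'C(n, k)%:R * sigma k * tau (n - k)%N.
Proof.
change (alt_conv _ n s t = alt_conv _ n sigma tau).
(* The sequences stay general: the induction hypothesis is used once with each pair shifted. *)
elim: n s sigma t tau hs ht => [|n IHn] s sigma t tau hs ht.
  by rewrite /alt_conv !big_nat1 hs ht !big_nat1 bin0 !mul1r.
rewrite !alt_convS -(IHn _ _ _ _ hs (binomial_pair2_shift _ _ _ ht)).
rewrite -(IHn _ _ _ _ (binomial_pair2_shift _ _ _ hs) ht).
by rewrite alt_convDl alt_convDr; ring.
Qed.
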